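(* Let $Y$ be a random variable satisfying the moment conditions stated in the context, let $0<q<1$, $x\in[0,1]$, $n\in\mathbb{N}_0$ and $r\in\{0,1,\dots,n\}$. Then the probabilistic $q$-Bernstein polynomials associated with $Y$ can be written in terms of the probabilistic Bernoulli polynomials of higher order associated with $Y$: $$B_{r,n}^{Y}(x,q)=\sum_{m=0}^{n}\binom{n}{m}\left\{{n-m \atop r}\right\}_{Y}\,\beta_{m,Y}^{(r)}\bigl(1-[x]_{q^{-1}}\bigr)\,[x]_q^{r}.$$
   Context: Moment conditions on the random variable $Y$: there is $\rho>0$ such that $\mathrm{E}[|Y|^n]<\infty$ for all $n\ge 0$ and $\lim_{n\to\infty}|v|^n\mathrm{E}[|Y|^n]/n!=0$ for $|v|<\rho$, where $\mathrm{E}$ denotes mathematical expectation. $q$-numbers: $[x]_q=\frac{q^x-1}{q-1}$ and $[x]_{q^{-1}}=\frac{q^{-x}-1}{q^{-1}-1}$; one has $[1-x]_q=1-[x]_{q^{-1}}$. Probabilistic $q$-Bernstein polynomials $B_{r,n}^Y(x,q)$: $\sum_{n=r}^{\infty}B_{r,n}^{Y}(x,q)\frac{v^n}{n!}=\frac{(v[x]_q)^r}{r!}\left(\mathrm{E}[e^{vY}]\right)^{[1-x]_q}$. Probabilistic Stirling numbers of the second kind: $\sum_{n=m}^{\infty}\left\{{n\atop m}\right\}_Y\frac{v^n}{n!}=\frac{(\mathrm{E}[e^{vY}]-1)^m}{m!}$, with $\left\{{n\atop m}\right\}_Y=0$ for $n<m$. Probabilistic Bernoulli polynomials of order $r$ associated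 with $Y$: $\sum_{n=0}^{\infty}\beta_{n,Y}^{(r)}(z)\frac{v^n}{n!}=\left(\frac{v}{\mathrm{E}[e^{vY}]-1}\right)^r\left(\mathrm{E}[e^{vY}]\right)^{z}$.
   Formalization: For r ≥ 1 it is assumed in addition that E[Y] ≠ 0; if E[Y] = 0, (v/(E[e^{vY}]−1))^r has a pole at v = 0 (or a zero denominator), so the probabilistic Bernoulli polynomials of order r are undefined. *)

(* Defs.v *)
From HB Require Import structures.
From mathcomp Require Import all_boot all_order all_algebra.
From mathcomp Require Import all_classical all_reals all_analysis.

Set Implicit Arguments.
Unset Strict Implicit.
Unset Printing Implicit Defensive.

Import Order.TTheory GRing.Theory Num.Theory.
Import numFieldNormedType.Exports.

Local Open Scope classical_set_scope.
Local Open Scope ring_scope.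

Definition moment_conditions d (T : measurableType d) (R : realType)
    (P : probability T R) (Y : {RV P >-> R}) : Prop :=
  exists rho : R,
    [/\ 0 < rho,
        forall n : nat, ('E_P[fun t => (`|Y t| ^+ n)%R] < +oo)%E
      & forall v : R, `|v| < rho ->
          `|v| ^+ n * fine 'E_P[fun t => `|Y t| ^+ n] / n`!%:R
            @[n --> \oo] --> (0 : R)].

(* [x]_q; the number [x]_{1/q} is [qnum q^-1 x]. *)
Definition qnum (R : realType) (q x : R) : R := (q `^ x - 1) / (q - 1).

(* F(v) = \sum_(n >= k) a_n v^n / n! for all small v <> 0. The point v = 0 is
   left out because the quotient v / (E[e^{vY}] - 1) is only defined there by
   continuity; a is still unique, since a power series is determined by its sum
   on a punctured neighborhood of 0. *)
Definition is_egf (R : realType) (k : nat) (F : R -> R) (a : R^nat) : Prop :=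
  (forall n : nat, (n < k)%N -> a n = 0) /\
  \forall v \near (0 : R)^', [series a n * (v ^+ n / n`!%:R)]_n @ \oo --> F v.

(* The coefficients of the expansion of F; an arbitrary sequence if there is
   no such expansion. *)
Definition egf_coef (R : realType) (k : nat) (F : R -> R) : R^nat :=
  get [set a : R^nat | is_egf k F a].

Section ProbabilisticNumbers.
Context d (T : measurableType d) (R : realType) (P : probability T R).
Variable Y : {RV P >-> R}.

(* E[e^{vY}] as a real number; finite near 0 under [moment_conditions]. *)
Definition mgf (v : R) : R := fine ('M_P Y v).

Definition prob_qBernstein (q x : R) (r n : nat) : R :=
  egf_coef r
    (fun v => (v * qnum q x) ^+ r / r`!%:R * mgf v `^ qnum q (1 - x)) n.

Definition prob_stirling2 (n m : nat) : R :=
  egf_coef m (fun v => (mgf v - 1) ^+ m / m`!%:R) n.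

(* For 0 < r the generating function has a power series expansion only when
   E[Y] <> 0: otherwise it has a pole at 0, or E[e^{vY}] - 1 vanishes
   identically. *)
Definition prob_bernoulli (r : nat) (z : R) (n : nat) : R :=
  egf_coef 0 (fun v => (v / (mgf v - 1)) ^+ r * mgf v `^ z) n.

End ProbabilisticNumbers.

(* Main.v *)
Require Import Defs.
From HB Require Import structures.
From mathcomp Require Import all_boot all_order all_algebra.
From mathcomp Require Import all_classical all_reals all_analysis.
From mathcomp Require Import measurable_realfun ring.

Set Implicit Arguments.
Unset Strict Implicit.
Unset Printing Implicit Defensive.

Import Order.TTheory GRing.Theory Num.Theory.
Import numFieldNormedType.Exports.

Local Open Scope classical_set_scope.
Local Open Scope ring_scope.

(* The identity compares coefficients in
     (v [x])^r / r! M^z = [x]^r * ((M - 1)^r / r!) * ((v / (M - 1))^r M^z),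
   where M(v) = E[e^{vY}] and z = [1 - x]_q. The work is to show that all
   factors have power series expansions at 0. For M this is dominated
   convergence under the moment conditions. A real power F^z of a series with
   F(0) = 1 is obtained by bounding geometrically the formal solution of
   F G' = z F' G; applied to F = (M - 1) / (v E[Y]) and exponent -r, it also
   gives the factor (v / (M - 1))^r. *)

(** * Power series at 0: convergence, differentiation, limits *)

Section PowerSeriesAtZero.
Context {R : realType}.
Implicit Types (a b : R^nat) (F G : R -> R).

(** The point 0 is excluded, as in [is_egf], so that quotients by [v] need no convention there. *)
Definition has_pseries F a : Prop :=
  \forall v \near (0 : R)^', pseries a v @ \oo --> F v.

(** Amounts to a positive radius of convergence, in a form that can be proved by induction from a
    recursion on the coefficients. *)
Definition geom_bounded a : Prop :=
  exists C K : R, [/\ 0 < C, 0 < K & forall n, `|a n| <= C * K ^+ n].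

Definition cauchy_prod a b : R^nat :=
  fun n => \sum_(i < n.+1) a i * b (n - i)%N.

Lemma near0_dnbhs (Q : set R) :
  (\forall v \near (0 : R), Q v) -> \forall v \near (0 : R)^', Q v.
Proof. exact: cvg_within. Qed.

Lemma near0_norm_lt (e : R) : 0 < e -> \forall v \near (0 : R), `|v| < e.
Proof. exact: nbhs0_lt. Qed.

(** The terms of a convergent series are bounded, which gives the ratio [K = 1 / |v|]. *)
Lemma pseries_geom_bounded a v : v != 0 -> cvgn (pseries a v) -> geom_bounded a.
Proof.
move=> v0 /cvg_series_bounded[M [Mr Mb]].
exists (`|M| + 1), (`|v|^-1); split.
- by rewrite ltr_wpDl.
- by rewrite invr_gt0 normr_gt0.
move=> n; rewrite exprVn ler_pdivlMr ?exprn_gt0 ?normr_gt0//.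
rewrite -normrX -normrM; apply: (Mb _ _ n I).
by rewrite (le_lt_trans (ler_norm _))// ltrDl.
Qed.

Lemma has_pseries_geom_bounded F a : has_pseries F a -> geom_bounded a.
Proof.
move=> Fa; near (0 : R)^' => v.
apply: (@pseries_geom_bounded _ v); first by near: v; exact: nbhs_dnbhs_neq.
by apply/cvg_ex; exists (F v); near: v.
Unshelve. all: by end_near. Qed.

(** At the point [1 / (2K)] the series is dominated by a geometric one of ratio 1/2; convergence
    there propagates to all smaller [v]. *)
Lemma geom_bounded_is_cvg a : geom_bounded a ->
  \forall v \near (0 : R), cvgn (pseries a v).
Proof.
move=> [C [K [C0 K0 aCK]]].
have K20 : 0 < (2 * K)^-1 by rewrite invr_gt0 mulr_gt0.
near=> v; apply: (@is_cvg_pseries_inside _ _ (2 * K)^-1); last first.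
  by rewrite (gtr0_norm K20); near: v; exact: near0_norm_lt.
apply: normed_cvg.
apply: (@series_le_cvg _ _ (geometric C (2^-1 : R))) => //.
- by move=> n; exact: normr_ge0.
- by move=> n; rewrite /geometric/= mulr_ge0 ?exprn_ge0 ?invr_ge0// ltW.
- move=> n /=; rewrite normrM.
  apply: (le_trans (ler_wpM2r (normr_ge0 _) (aCK n))).
  rewrite ger0_norm ?exprn_ge0 ?(ltW K20)// -mulrA -exprMn invfM.
  by rewrite mulrCA mulfV ?mulr1// gt_eqF.
- apply: is_cvg_geometric_series.
  by rewrite ger0_norm ?invr_ge0// invf_lt1 ?ltr1n.
Unshelve. all: by end_near. Qed.

Lemma geom_bounded_has_pseries a : geom_bounded a ->
  has_pseries (fun v => limn (pseries a v)) a.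
Proof. by move=> /geom_bounded_is_cvg/near0_dnbhs; apply: filterS. Qed.

Lemma has_pseries_lim F a : has_pseries F a ->
  \forall v \near (0 : R)^', F v = limn (pseries a v).
Proof. by apply: filterS => v /cvg_lim ->. Qed.

Lemma near_has_pseries F G a : (\forall v \near (0 : R)^', F v = G v) ->
  has_pseries F a -> has_pseries G a.
Proof. by apply: filterS2 => v ->. Qed.

Lemma pseries0 a n : pseries a 0 n.+1 = a 0%N.
Proof.
rewrite /pseries/= /series/= big_nat_recl//= big1 ?addr0 ?expr0 ?mulr1// => i _.
by rewrite expr0n mulr0.
Qed.

Lemma lim_pseries0 a : limn (pseries a 0) = a 0%N.
Proof.
apply/cvg_lim => //; rewrite -cvg_shiftS.
by apply: cvg_near_cst; apply: nearW => n; exact: pseries0.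
Qed.

Lemma natr_le_exp2 n : n.+1%:R <= 2 ^+ n :> R.
Proof. by rewrite -natrX ler_nat ltn_expl. Qed.

Lemma geom_bounded_diffs a : geom_bounded a -> geom_bounded (pseries_diffs a).
Proof.
move=> [C [K [C0 K0 aCK]]]; exists (C * K), (2 * K); split; rewrite ?mulr_gt0//.
move=> n; rewrite /pseries_diffs normrM normr_nat.
apply: (le_trans (ler_pM _ _ (natr_le_exp2 n) (aCK n.+1))) => //.
by rewrite le_eqVlt exprS exprMn; apply/orP; left; apply/eqP; ring.
Qed.

(** Termwise differentiation needs the series and its first two formal derivatives to converge at a
    point [r] with [|v| < |r|]; formal derivatives stay geometrically bounded, so one small [r]
    serves all three. *)
Lemma geom_bounded_is_derive a : geom_bounded a -> \forall v \near (0 : R),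
  is_derive v (1 : R) (fun x => limn (pseries a x))
    (limn (pseries (pseries_diffs a) v)).
Proof.
move=> a0; have a1 := geom_bounded_diffs a0.
have a2 := geom_bounded_diffs a1.
near (0 : R)^' => r.
have r0 : r != 0 by near: r; exact: nbhs_dnbhs_neq.
near=> v; apply: (@pseries_snd_diffs _ _ r).
- by near: r; exact/near0_dnbhs/geom_bounded_is_cvg.
- by near: r; exact/near0_dnbhs/geom_bounded_is_cvg.
- by near: r; exact/near0_dnbhs/geom_bounded_is_cvg.
- by near: v; apply: near0_norm_lt; rewrite normr_gt0.
Unshelve. all: by end_near. Qed.

Lemma geom_bounded_cvg0 a : geom_bounded a ->
  limn (pseries a v) @[v --> 0] --> a 0%N.
Proof.
move=> /geom_bounded_is_derive/nbhs_singleton[d _].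
rewrite -[X in _ --> X]lim_pseries0.
exact/differentiable_continuous/derivable1_diffP.
Qed.

(** Recovers the constant coefficient as a limit, since the value [F 0] is unconstrained. *)
Lemma has_pseries_cvg0 F a : has_pseries F a -> F v @[v --> 0^'] --> a 0%N.
Proof.
move=> Fa; have := has_pseries_geom_bounded Fa => /geom_bounded_cvg0.
move=> /cvg_within_filter /(cvg_trans _); apply.
by apply: near_eq_cvg; apply: filterS (has_pseries_lim Fa).
Qed.

(** * Uniqueness of the coefficients and linear operations *)

Lemma has_pseries_shift F a : has_pseries F a ->
  has_pseries (fun v => (F v - a 0%N) / v) (fun n => a n.+1).
Proof.
move=> Fa; near=> v.
have v0 : v != 0 by near: v; exact: nbhs_dnbhs_neq.
have -> : pseries (fun n => a n.+1) v =
    (fun n => (pseries a v n.+1 - a 0%N) / v).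
  apply/funext => n; rewrite /pseries/= /series/= big_nat_recl//=.
  rewrite expr0 mulr1 addrC addKr mulr_suml; apply: eq_bigr => i _.
  by rewrite exprSr mulrA mulfK.
apply: cvgM (cvg_cst _); apply: cvgB (cvg_cst _).
by rewrite cvg_shiftS; near: v.
Unshelve. all: by end_near. Qed.

(** The limit at 0 kills the constant coefficient; dividing by [v] then moves the next coefficient
    to that position. *)
Lemma has_pseries0_eq0 a n : has_pseries (fun=> 0) a -> a n = 0.
Proof.
elim: n a => [|n IH] a a0.
  by apply/esym; apply: (cvg_unique _ (cvg_cst 0) (has_pseries_cvg0 a0)).
have a00 : a 0%N = 0.
  by apply/esym; apply: (cvg_unique _ (cvg_cst 0) (has_pseries_cvg0 a0)).
apply: (IH (fun n => a n.+1)); apply: near_has_pseries (has_pseries_shift a0).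
by apply: nearW => v; rewrite a00 subrr mul0r.
Qed.

Lemma has_pseriesB F G a b : has_pseries F a -> has_pseries G b ->
  has_pseries (fun v => F v - G v) (fun n => a n - b n).
Proof.
apply: filterS2 => v Fa Gb.
have -> : pseries (fun n => a n - b n) v = pseries a v \- pseries b v.
  apply/funext => k /=; rewrite /pseries /series/= -sumrB.
  by apply: eq_bigr => i _; rewrite mulrBl.
exact: cvgB.
Qed.

Lemma has_pseries_uniq F a b : has_pseries F a -> has_pseries F b -> a = b.
Proof.
move=> Fa Fb; apply/funext => n; apply/eqP; rewrite -subr_eq0; apply/eqP.
apply: (@has_pseries0_eq0 (fun n => a n - b n)).
apply: near_has_pseries (has_pseriesB Fa Fb).
by apply: nearW => v; rewrite subrr.
Qed.

Lemma has_pseriesZ c F a : has_pseries F a ->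
  has_pseries (fun v => c * F v) (fun n => c * a n).
Proof.
apply: filterS => v Fa.
have -> : pseries (fun n => c * a n) v = fun n => c * pseries a v n.
  apply/funext => k /=; rewrite /pseries /series/= mulr_sumr.
  by apply: eq_bigr => i _; rewrite mulrA.
exact: cvgM (cvg_cst _) Fa.
Qed.

Lemma has_pseries1 : has_pseries (fun=> 1) (fun n => (n == 0)%N%:R).
Proof.
apply: nearW => v; rewrite -cvg_shiftS; apply: cvg_near_cst; apply: nearW => n.
rewrite /pseries/= /series/= big_nat_recl//= big1 ?addr0 ?expr0 ?mulr1// => i _.
by rewrite mul0r.
Qed.


(** * Products of power series *)

Lemma geom_bounded2 a b : geom_bounded a -> geom_bounded b ->
  exists C K : R, [/\ 0 < C, 0 < K,
    forall n, `|a n| <= C * K ^+ n & forall n, `|b n| <= C * K ^+ n].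
Proof.
move=> [C1 [K1 [C10 K10 ha]]] [C2 [K2 [C20 K20 hb]]].
exists (C1 + C2), (K1 + K2); split; rewrite ?addr_gt0// => n.
  apply: (le_trans (ha n)).
  rewrite ler_pM ?exprn_ge0 ?lerDl ?(ltW C10) ?(ltW K10) ?(ltW C20)//.
  by rewrite lerXn2r ?nnegrE ?lerDl ?addr_ge0// ltW.
apply: (le_trans (hb n)).
rewrite ler_pM ?exprn_ge0 ?lerDr ?(ltW C20) ?(ltW K20) ?(ltW C10)//.
by rewrite lerXn2r ?nnegrE ?lerDr ?addr_ge0// ltW.
Qed.

(* The product of the N-th partial sums agrees with the N-th partial sum of the
   Cauchy product below degree N, and has degree less than 2N. *)
Lemma pseriesM_dist a b (C K v : R) N : 0 < C -> 0 < K -> `|v| < (8 * K)^-1 ->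
  (forall n, `|a n| <= C * K ^+ n) -> (forall n, `|b n| <= C * K ^+ n) ->
  `|pseries a v N * pseries b v N - pseries (cauchy_prod a b) v N|
    <= geometric (C ^+ 2) 2^-1 N.
Proof.
move=> C0 K0 vK ha hb.
pose p := \poly_(i < N) a i; pose q := \poly_(i < N) b i.
have pE c : pseries c v N = (\poly_(i < N) c i).[v].
  by rewrite horner_poly /pseries /series/= big_mkord.
have pqE : (p * q).[v] = \sum_(0 <= i < N + N) (p * q)`_i * v ^+ i.
  rewrite big_mkord; apply: horner_coef_wide.
  apply: (leq_trans (size_polyMleq _ _)); apply: (leq_trans (leq_pred _)).
  by rewrite leq_add ?size_poly.
have coefE i : (i < N)%N -> (p * q)`_i = cauchy_prod a b i.
  move=> iN; rewrite coefM; apply: eq_bigr => j _.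
  have jN : (j < N)%N by rewrite (leq_ltn_trans _ iN)// -ltnS.
  by rewrite !coef_poly jN (leq_ltn_trans (leq_subr _ _) iN).
rewrite 2!pE -hornerM pqE (big_cat_nat (n := N))//= ?leq_addr//.
have -> : \sum_(0 <= i < N) (p * q)`_i * v ^+ i = pseries (cauchy_prod a b) v N.
  rewrite /pseries /series/=; apply: eq_big_nat => i /andP[_ iN].
  by rewrite coefE.
rewrite addrAC subrr add0r.
(* The coefficient of degree [i] is at most [(i + 1) C^2 K^i], and [i + 1 <= 2^i]; the bound
   [|v| < 1 / (8K)] therefore leaves the ratio 2/8 = 1/4. *)
have cbound i : `|(p * q)`_i * v ^+ i| <= C ^+ 2 * 4^-1 ^+ i.
  rewrite normrM coefM.
  have h : `|\sum_(j < i.+1) p`_j * q`_(i - j)| <= i.+1%:R * (C ^+ 2 * K ^+ i).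
    apply: (le_trans (ler_norm_sum _ _ _)).
    rewrite -[X in X%:R](card_ord i.+1) mulr_natl -sumr_const.
    apply: ler_sum => j _.
    have -> : C ^+ 2 * K ^+ i = (C * K ^+ j) * (C * K ^+ (i - j)).
      by rewrite mulrACA -exprD subnKC// -ltnS.
    rewrite normrM ler_pM// coef_poly; case: ifPn => _ //.
      by rewrite normr0 mulr_ge0 ?exprn_ge0// ltW.
    by rewrite normr0 mulr_ge0 ?exprn_ge0// ltW.
  apply: (le_trans (ler_wpM2r (normr_ge0 _) h)).
  have h2 : `|v ^+ i| <= (8 * K)^-1 ^+ i.
    by rewrite normrX lerXn2r ?nnegrE ?invr_ge0 ?mulr_ge0 ?(ltW K0) ?(ltW vK).
  have h3 : i.+1%:R * (C ^+ 2 * K ^+ i) <= 2 ^+ i * (C ^+ 2 * K ^+ i).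
    by rewrite ler_wpM2r ?natr_le_exp2// mulr_ge0 ?exprn_ge0// ltW.
  apply: (le_trans (ler_pM _ _ h3 h2)) => //.
    by rewrite mulr_ge0 ?mulr_ge0 ?exprn_ge0// ltW.
  rewrite le_eqVlt; apply/orP; left; apply/eqP.
  have -> : (4^-1 : R) ^+ i = 2 ^+ i * K ^+ i * (8 * K)^-1 ^+ i.
    by rewrite -!exprMn; congr GRing.exp; field; rewrite gt_eqF.
  ring.
apply: (le_trans (ler_norm_sum _ _ _)).
(* The tail has [N] terms, each at most [C^2 4^-N], and [N <= 2^N] turns [N 4^-N] into [2^-N]. *)
apply: (@le_trans _ _ (\sum_(N <= i < N + N) C ^+ 2 * 4^-1 ^+ N)).
  apply: ler_sum_nat => i /andP[Ni _]; apply: (le_trans (cbound i)).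
  rewrite ler_wpM2l ?exprn_ge0 ?(ltW C0)//.
  by apply: ler_wiXn2l => //; rewrite ?invr_ge0// invf_le1// ler1n.
rewrite sumr_const_nat addnK -mulrnAr /geometric/=.
rewrite ler_wpM2l ?exprn_ge0 ?(ltW C0)// -mulr_natl.
have -> : (2^-1 : R) ^+ N = 2 ^+ N * 4^-1 ^+ N.
  by rewrite -exprMn; congr (_ ^+ _); field.
rewrite ler_wpM2r ?exprn_ge0 ?invr_ge0//.
by apply: le_trans (natr_le_exp2 N); rewrite ler_nat.
Qed.

Lemma has_pseriesM F G a b : has_pseries F a -> has_pseries G b ->
  has_pseries (fun v => F v * G v) (cauchy_prod a b).
Proof.
move=> Fa Gb.
have [C [K [C0 K0 ha hb]]] := geom_bounded2
  (has_pseries_geom_bounded Fa) (has_pseries_geom_bounded Gb).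
near=> v.
have vK : `|v| < (8 * K)^-1.
  by near: v; apply/near0_dnbhs/near0_norm_lt; rewrite invr_gt0 mulr_gt0.
have FGv : pseries a v n * pseries b v n @[n --> \oo] --> F v * G v.
  by apply: cvgM; near: v.
rewrite -[F v * G v]subr0.
have -> : pseries (cauchy_prod a b) v =
  (fun n => pseries a v n * pseries b v n -
    (pseries a v n * pseries b v n - pseries (cauchy_prod a b) v n)).
  by apply/funext => n; rewrite subKr.
apply: cvgB => //.
apply: norm_cvg0.
apply: (@squeeze_cvgr _ _ _ _ (fun=> 0) (geometric (C ^+ 2) (2^-1 : R))).
- apply: nearW => N; rewrite normr_ge0/=.
  exact: (pseriesM_dist N C0 K0 vK ha hb).
- exact: cvg_cst.
- by apply: cvg_geometric; rewrite ger0_norm ?invr_ge0// invf_lt1 ?ltr1n.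
Unshelve. all: by end_near. Qed.

(** * Real powers of a power series with constant term 1 *)

(* Recursion read off F G' = z F' G for G = F `^ z with F 0 = 1. The list holds
   the coefficients of G in decreasing order of the index, so that its j-th
   entry at stage n is the coefficient n - j. *)
Fixpoint powR_coefs (z : R) f n : seq R :=
  if n is m.+1 then
    let l := powR_coefs z f m in
    (m.+1%:R^-1 * \sum_(j < m.+1)
       (z * j.+1%:R - (m - j)%:R) * f j.+1 * nth 0 l j) :: l
  else [:: 1].

Definition powR_coef (z : R) f : R^nat := fun n => nth 0 (powR_coefs z f n) 0.

Lemma nth_powR_coefs z f n j : (j <= n)%N ->
  nth 0 (powR_coefs z f n) j = powR_coef z f (n - j)%N.
Proof.
elim: n j => [|n IH] [|j] // jn.
by rewrite /= IH.
Qed.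

Lemma powR_coefS z f n : powR_coef z f n.+1 = n.+1%:R^-1 *
  \sum_(j < n.+1) (z * j.+1%:R - (n - j)%:R) * f j.+1 * powR_coef z f (n - j)%N.
Proof.
rewrite {1}/powR_coef /=; congr (_ * _); apply: eq_bigr => j _.
by rewrite nth_powR_coefs// -ltnS.
Qed.

(** Strong induction. The ratio [M = K + c] is chosen so that factoring [M^(n+1) - K^(n+1)] by
    [M - K = c] produces a sum matching the recursion term by term. *)
Lemma powR_coef_geom_bounded z f : geom_bounded f ->
  geom_bounded (powR_coef z f).
Proof.
move=> [C [K [C0 K0 fCK]]].
pose c := (`|z| + 1) * C * K; pose M := K + c.
have c0 : 0 < c by rewrite !mulr_gt0// ltr_wpDl.
have M0 : 0 < M by rewrite addr_gt0.
exists 1, M; split => // n; rewrite mul1r.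
elim/ltn_ind: n => -[|n] IH; first by rewrite /powR_coef /= normr1 expr0.
have -> : M ^+ n.+1 = K ^+ n.+1 + \sum_(j < n.+1) c * K ^+ j * M ^+ (n - j).
  apply/eqP; rewrite addrC -subr_eq subrXX {1}/M addrAC subrr add0r mulr_sumr.
  by apply/eqP; apply: eq_bigr => j _; rewrite /= [_ * K ^+ j]mulrC mulrA.
rewrite ler_wpDl ?exprn_ge0 ?(ltW K0)// powR_coefS mulr_sumr.
apply: (le_trans (ler_norm_sum _ _ _)); apply: ler_sum => j _.
rewrite !normrM mulrA; apply: ler_pM => //; last first.
  by apply: IH; rewrite ltnS leq_subr.
(* The factor [|z| + 1] in [c] absorbs the weight of the recursion: [|z (j + 1) - (n - j)| <= (|z| +
   1) (n + 1)]. *)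
have -> : c * K ^+ j = (`|z| + 1) * (C * K ^+ j.+1) by rewrite /c exprS; ring.
rewrite mulrA; apply: ler_pM => //.
rewrite normfV normr_nat ler_pdivrMl ?ltr0n//.
apply: (le_trans (ler_normB _ _)).
rewrite normrM !normr_nat mulrDr mulr1 lerD//.
  by rewrite mulrC ler_wpM2r// ler_nat.
by rewrite ler_nat (leq_trans (leq_subr _ _)).
Qed.

(** This is F G' = z F' G on coefficients. As [f 0 = 1], the first term on the left is [n + 1] times
    the new coefficient of G; expanding it by the recursion, its [-(n - j)] part cancels the other
    terms. *)
Lemma powR_coef_ode z f : f 0%N = 1 ->
  cauchy_prod f (pseries_diffs (powR_coef z f)) =
  (fun n => z * cauchy_prod (pseries_diffs f) (powR_coef z f) n).
Proof.
move=> f0; apply/funext => n; rewrite /cauchy_prod /pseries_diffs.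
rewrite big_ord_recl f0 mul1r subn0 powR_coefS mulVKf ?pnatr_eq0//.
rewrite [in LHS]big_ord_recr/= subnn subr0.
have -> : \sum_(i < n) f (bump 0 i) *
      ((n - bump 0 i).+1%:R * powR_coef z f (n - bump 0 i)%N.+1) =
    \sum_(i < n) (n - i)%:R * f i.+1 * powR_coef z f (n - i)%N.
  apply: eq_bigr => i _; rewrite /bump/= add1n subnS prednK ?subn_gt0//.
  by rewrite mulrA [_ * f _]mulrC.
rewrite [in RHS]big_ord_recr/= subnn mulrDr addrAC -big_split/= mulr_sumr.
congr (_ + _); last by rewrite !mulrA.
by apply: eq_bigr => i _; ring.
Qed.

(** The derivative is known only off 0, so the mean value theorem is applied between 0 and [v],
    where continuity suffices at the endpoint 0. *)
Lemma derive0_near_cst (F : R -> R) : {for 0, continuous F} ->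
  (\forall v \near (0 : R)^', is_derive v (1 : R) F 0) ->
  \forall v \near (0 : R), F v = F 0.
Proof.
move=> F0 /nbhs_ballP[e /= e0 dF].
have dF' v : `|v| < e -> v != 0 -> is_derive v (1 : R) F 0.
  by move=> ve; apply: dF; rewrite /ball/= sub0r normrN.
have cF v : `|v| < e -> {for v, continuous F}.
  have [->//|v0 ve] := eqVneq v 0; have [d _] := dF' _ ve v0.
  exact/differentiable_continuous/derivable1_diffP.
near=> v.
have ve : `|v| < e by near: v; exact: near0_norm_lt.
have [v0|v0|->//] := ltgtP v 0.
  have le_e x : x \in `[v, 0] -> `|x| < e.
    rewrite in_itv/= => /andP[vx x0]; rewrite (le_lt_trans _ ve)//.
    by rewrite !ler0_norm ?lerN2// ltW.
  have [x||x _] := @MVT R F (fun=> 0) v 0 v0.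
  - move=> xv; apply: dF'; first exact/le_e/subset_itv_oo_cc.
    by move: xv; rewrite in_itv/= => /andP[_ /lt_eqF ->].
  - by apply: continuous_in_subspaceT => x /set_mem/= /le_e; exact: cF.
  - by rewrite mul0r => /eqP; rewrite subr_eq0 => /eqP.
have le_e x : x \in `[0, v] -> `|x| < e.
  rewrite in_itv/= => /andP[x0 xv]; rewrite (le_lt_trans _ ve)//.
  by rewrite !ger0_norm// ltW.
have [x||x _] := @MVT R F (fun=> 0) 0 v v0.
- move=> xv; apply: dF'; first exact/le_e/subset_itv_oo_cc.
  by move: xv; rewrite in_itv/= => /andP[/gt_eqF -> _].
- by apply: continuous_in_subspaceT => x /set_mem/= /le_e; exact: cF.
- by rewrite mul0r => /eqP; rewrite subr_eq0 => /eqP.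
Unshelve. all: by end_near. Qed.

Lemma has_pseries_gt0 F a : has_pseries F a -> 0 < a 0%N ->
  \forall v \near (0 : R)^', 0 < F v.
Proof.
by move=> Fa a0; have := has_pseries_cvg0 Fa => /cvgr_gt; apply.
Qed.

Lemma has_pseries_powR F f z : has_pseries F f -> f 0%N = 1 ->
  has_pseries (fun v => F v `^ z) (powR_coef z f).
Proof.
move=> Ff f0.
have gf := has_pseries_geom_bounded Ff.
have gg := powR_coef_geom_bounded z gf.
(* [F] is replaced by the sum [f1] of its series, which is differentiable near 0 with [f1 0 = 1],
   whereas [F] is controlled only off 0. *)
pose f1 v := limn (pseries f v); pose g1 v := limn (pseries (powR_coef z f) v).
pose df v := limn (pseries (pseries_diffs f) v).
pose dg v := limn (pseries (pseries_diffs (powR_coef z f)) v).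
have f1E : \forall v \near (0 : R)^', F v = f1 v by exact: has_pseries_lim.
have ode : \forall v \near (0 : R)^', f1 v * dg v = z * (df v * g1 v).
  have h1 := has_pseriesM (geom_bounded_has_pseries gf)
    (geom_bounded_has_pseries (geom_bounded_diffs gg)).
  have h2 := has_pseriesZ z (has_pseriesM
    (geom_bounded_has_pseries (geom_bounded_diffs gf))
    (geom_bounded_has_pseries gg)).
  rewrite powR_coef_ode// in h1.
  near=> v; apply: (@cvg_unique _ _ (pseries (fun n =>
    z * cauchy_prod (pseries_diffs f) (powR_coef z f) n) v @ \oo)) => //.
  - by near: v.
  - by near: v.
have f1_gt0 : \forall v \near (0 : R), 0 < f1 v.
  have := geom_bounded_cvg0 gf => /cvgr_gt; apply; by rewrite f0.
have f10 : f1 0 = 1 by rewrite /f1 lim_pseries0.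
(* The quotient of the formal solution by the true power has a derivative proportional to the defect
   of the differential equation, hence is constant, equal to its value 1 at 0. *)
have phi0 : \forall v \near (0 : R), is_derive v (1 : R)
    (fun v => g1 v * f1 v `^ (- z))
    (f1 v `^ (- z - 1) * (f1 v * dg v - z * (df v * g1 v))).
  near=> v.
  have fv : 0 < f1 v by near: v.
  have Hf : is_derive v (1 : R) f1 (df v)
    by near: v; exact: geom_bounded_is_derive.
  have Hg : is_derive v (1 : R) g1 (dg v)
    by near: v; exact: geom_bounded_is_derive.
  have Hp : is_derive v (1 : R) ((fun y => y `^ (- z)) \o f1)
     ((- z * f1 v `^ (- z - 1)) * df v).
    by apply: is_derive1_comp; [exact: (is_derive1_powR (- z) fv)|exact: Hf].
  apply: (is_derive_eq (is_deriveM Hg Hp)).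
  rewrite /= /GRing.scale/=.
  have -> : f1 v `^ (- z) = f1 v * f1 v `^ (- z - 1).
    rewrite -{2}[f1 v]powRr1 ?(ltW fv)// -powRD.
      by congr powR; ring.
    by rewrite (gt_eqF fv) implybT.
  ring.
have phi_cst : \forall v \near (0 : R),
    g1 v * f1 v `^ (- z) = g1 0 * f1 0 `^ (- z).
  apply: (@derive0_near_cst (fun v => g1 v * f1 v `^ (- z))).
    have [d _] := nbhs_singleton phi0.
    exact/differentiable_continuous/derivable1_diffP.
  near=> v.
  have -> : (0 : R) = f1 v `^ (- z - 1) * (f1 v * dg v - z * (df v * g1 v)).
    by rewrite (_ : f1 v * dg v = z * (df v * g1 v)) ?subrr ?mulr0//; near: v.
  by near: v; exact: near0_dnbhs.
apply: near_has_pseries (geom_bounded_has_pseries gg).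
near=> v.
have -> : F v = f1 v by near: v.
have fv : 0 < f1 v by near: v; exact: near0_dnbhs.
have : g1 v * f1 v `^ (- z) = g1 0 * f1 0 `^ (- z).
  by near: v; exact: near0_dnbhs.
have g10 : g1 0 = 1 by rewrite /g1 lim_pseries0.
by rewrite g10 f10 powR1 mul1r powRN => /divr1_eq.
Unshelve. all: by end_near. Qed.

(** The vanishing of the first [r] coefficients is what [is_egf r] requires of the Stirling
    generating function. *)
Lemma has_pseriesX F a r : has_pseries F a -> a 0%N = 0 ->
  exists2 b, has_pseries (fun v => F v ^+ r) b & forall n, (n < r)%N -> b n = 0.
Proof.
move=> Fa a0; elim: r => [|r [b Fb b0]].
  exists (fun n => (n == 0)%N%:R) => //.
  by under eq_fun do rewrite expr0; exact: has_pseries1.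
exists (cauchy_prod b a).
  by under eq_fun do rewrite exprSr; exact: has_pseriesM.
move=> n nr; rewrite /cauchy_prod big1// => i _.
have [ir|ri] := ltnP i r; first by rewrite b0 ?mul0r.
rewrite (_ : (n - i)%N = 0%N) ?a0 ?mulr0//; apply/eqP; rewrite subn_eq0.
by rewrite (leq_trans _ ri).
Qed.

End PowerSeriesAtZero.

(** * Expansion of the moment generating function *)

Section MomentGeneratingFunction.
Context d (T : measurableType d) (R : realType) (P : probability T R).
Variable Y : {RV P >-> R}.
Hypothesis hY : moment_conditions Y.

Definition moment n : R := fine 'E_P[fun t => Y t ^+ n].
Definition abs_moment n : R := fine 'E_P[fun t => `|Y t| ^+ n].

Lemma measurable_momentX n : measurable_fun [set: T] (fun t => Y t ^+ n).
Proof. exact: measurable_funX. Qed.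

Lemma measurable_abs_momentX n : measurable_fun [set: T] (fun t => `|Y t| ^+ n).
Proof. by apply: measurable_funX; exact: measurableT_comp. Qed.

Lemma abs_momentE n :
  (\int[P]_t (`|Y t| ^+ n)%:E)%E = (abs_moment n)%:E.
Proof.
have [rho [_ fin _]] := hY; rewrite /abs_moment.
have := fin n; rewrite unlock => lty; rewrite fineK// ge0_fin_numE//.
by apply: integral_ge0 => t _; rewrite lee_fin exprn_ge0.
Qed.

Lemma integrable_moment n : P.-integrable [set: T] (fun t => (Y t ^+ n)%:E).
Proof.
apply/integrableP; split.
  by apply/measurable_EFinP; exact: measurable_momentX.
under eq_integral do rewrite abse_EFin normrX.
by rewrite abs_momentE ltry.
Qed.

Lemma momentE n : (\int[P]_t (Y t ^+ n)%:E)%E = (moment n)%:E.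
Proof.
rewrite /moment unlock fineK// integrable_fin_num//.
exact: integrable_moment.
Qed.

(** The moment condition at [rho / 2] gives a convergent, hence bounded, sequence; this yields the
    ratio [2 / rho]. *)
Lemma abs_moment_geom_bounded : geom_bounded (fun n => abs_moment n / n`!%:R).
Proof.
have [rho [rho0 _ lim0]] := hY.
have r2 : 0 < rho / 2 by rewrite divr_gt0.
have /lim0 : `|rho / 2| < rho.
  by rewrite gtr0_norm// ltr_pdivrMr// ltr_pMr// ltr1n.
move=> /cvgP/cvg_seq_bounded/pinfty_ex_gt0[M M0 /= Mb].
exists M, (rho / 2)^-1; split; rewrite ?invr_gt0// => n.
rewrite exprVn ler_pdivlMr ?exprn_gt0//; apply: le_trans (Mb n I).
rewrite (gtr0_norm r2) /abs_moment.
rewrite -[X in _ * X](gtr0_norm (exprn_gt0 n r2)) -normrM.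
rewrite le_eqVlt; apply/orP; left; apply/eqP.
by congr (`| _ |); rewrite mulrC mulrA.
Qed.

Lemma near0_abs_moment_cvg : \forall v \near (0 : R),
  cvgn (pseries (fun n => abs_moment n / n`!%:R) `|v|).
Proof.
near (0 : R)^' => r.
have r0 : r != 0 by near: r; exact: nbhs_dnbhs_neq.
near=> v; apply: (@is_cvg_pseries_inside _ _ r).
  by near: r; exact/near0_dnbhs/geom_bounded_is_cvg/abs_moment_geom_bounded.
by rewrite normr_id; near: v; apply: near0_norm_lt; rewrite normr_gt0.
Unshelve. all: by end_near. Qed.

Lemma exp_coeff_absE (x : R) n : `|exp_coeff x n| = exp_coeff `|x| n.
Proof. by rewrite /exp_coeff/= normrM normrX normfV normr_nat. Qed.

Lemma series_exp_coeff_le (x : R) n : `|series (exp_coeff x) n| <= expR `|x|.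
Proof.
apply: (@le_trans _ _ (series (exp_coeff `|x|) n)).
  apply: (le_trans (ler_norm_sum _ _ _)).
  by apply: ler_sum => i _; rewrite exp_coeff_absE.
apply: nondecreasing_cvgn_le; last exact: is_cvg_series_exp_coeff.
by apply: nondecreasing_series => i _ _; exact: exp_coeff_ge0.
Qed.

(** The exponential series of [|Y v|] has nonnegative terms, so sum and integral may be exchanged.
    The result is the dominating function for [mgf_has_pseries]. *)
Lemma integrable_expR_abs v :
  cvgn (pseries (fun n => abs_moment n / n`!%:R) `|v|) ->
  P.-integrable [set: T] (fun t => (expR `|Y t * v|)%:E).
Proof.
move=> cv; apply/integrableP; split.
  apply/measurable_EFinP; apply: measurableT_comp => //.
  by apply: measurableT_comp => //; exact: measurable_funM.
have intE n : (\int[P]_t (exp_coeff `|Y t * v| n)%:E)%E =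
    (abs_moment n / n`!%:R * `|v| ^+ n)%:E.
  transitivity (\int[P]_t ((`|v| ^+ n / n`!%:R)%:E * (`|Y t| ^+ n)%:E))%E.
    apply: eq_integral => t _; rewrite -EFinM /exp_coeff/= normrM exprMn.
    by congr EFin; ring.
  rewrite ge0_integralZl//.
  - by rewrite abs_momentE -EFinM; congr EFin; ring.
  - by apply/measurable_EFinP; exact: measurable_abs_momentX.
have -> : (\int[P]_t `|(expR `|Y t * v|)%:E|)%E =
    (\int[P]_t \sum_(n <oo) (exp_coeff `|Y t * v| n)%:E)%E.
  apply: eq_integral => t _; rewrite abse_EFin ger0_norm ?expR_ge0// /expR.
  rewrite -EFin_lim; last exact: is_cvg_series_exp_coeff.
  by congr (limn _); apply/funext => n; rewrite /series/= sumEFin.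
rewrite integral_nneseries//; last 2 first.
- move=> n; apply/measurable_EFinP; apply: measurable_funM => //.
  apply: measurable_funX; apply: measurableT_comp => //.
  exact: measurable_funM.
- by move=> n t _; rewrite lee_fin exp_coeff_ge0.
rewrite (eq_eseriesr (fun n _ => intE n)).
have -> : (\sum_(n <oo) (abs_moment n / n`!%:R * `|v| ^+ n)%:E)%E =
    (limn (pseries (fun n => abs_moment n / n`!%:R) `|v|))%:E.
  rewrite -EFin_lim//; congr (limn _); apply/funext => n.
  by rewrite /pseries/series/= sumEFin.
exact: ltry.
Qed.

Lemma mgf_has_pseries : has_pseries (mgf Y) (fun n => moment n / n`!%:R).
Proof.
apply: near0_dnbhs; near=> v.
have cv : cvgn (pseries (fun n => abs_moment n / n`!%:R) `|v|).
  by near: v; exact: near0_abs_moment_cvg.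
have ig := integrable_expR_abs cv.
pose f_ n t : \bar R := (series (exp_coeff (Y t * v)) n)%:E.
have mE t n : exp_coeff (Y t * v) n = v ^+ n / n`!%:R * Y t ^+ n.
  by rewrite /exp_coeff/= exprMn; ring.
have mf n : measurable_fun [set: T] (f_ n).
  apply/measurable_EFinP; rewrite /series/=; apply: measurable_sum => i.
  under eq_fun do rewrite mE.
  by apply: measurable_funM => //; exact: measurable_momentX.
have intf n : (\int[P]_t f_ n t)%E =
    (pseries (fun n => moment n / n`!%:R) v n)%:E.
  rewrite /f_ /series/=.
  under eq_integral do rewrite -sumEFin.
  rewrite integral_sum//; last first.
    move=> k; under eq_fun do rewrite mE EFinM.
    by apply: integrableZl => //; exact: integrable_moment.
  rewrite /pseries/series/= -sumEFin; apply: eq_bigr => i _.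
  under eq_integral do rewrite mE EFinM.
  rewrite integralZl//; last exact: integrable_moment.
  by rewrite momentE -EFinM; congr EFin; ring.
have cvf t : [set: T] t -> f_ ^~ t @ \oo --> (expR (Y t * v))%:E.
  move=> _; apply: cvg_EFin; first exact: nearW.
  exact: is_cvg_series_exp_coeff.
have mexp : measurable_fun [set: T] (fun t => (expR (Y t * v))%:E).
  apply/measurable_EFinP; apply: measurableT_comp => //.
  exact: measurable_funM.
have := dominated_cvg measurableT mf cvf _ ig _.
(* [mgf] is defined through [fine], so finiteness must be shown: exp(Yv) is at most the integrable
   exp|Yv|. *)
have -> : (\int[P]_t (expR (Y t * v))%:E)%E = (mgf Y v)%:E.
  rewrite /mgf /mmt_gen_fun unlock fineK//.
  apply: integrable_fin_num => //.
  apply: le_integrable ig => // t _.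
  rewrite lee_fin ger0_norm ?expR_ge0// ger0_norm ?expR_ge0//.
  by rewrite ler_expR ler_norm.
move=> H.
have /fine_cvg : (pseries (fun n => moment n / n`!%:R) v n)%:E @[n --> \oo] -->
    (mgf Y v)%:E.
  rewrite (_ : (fun n => _) = fun n => (\int[P]_t f_ n t)%E); last exact/funext.
  by apply: H => // n t _; rewrite lee_fin series_exp_coeff_le.
by [].
Unshelve. all: by end_near. Qed.

Lemma moment0 : moment 0 = 1.
Proof.
have -> : moment 0 = fine 'E_P[cst 1] by congr (fine 'E_P[_]); apply/funext.
by rewrite expectation_cst.
Qed.

Lemma moment1 : (moment 1)%:E = 'E_P[Y]%E.
Proof.
by rewrite -momentE unlock; apply: eq_integral => t _; rewrite expr1.
Qed.

End MomentGeneratingFunction.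
Arguments moment {d T R P} Y n.

(** * Exponential generating functions and their coefficients *)

Section ExponentialGeneratingFunction.
Context {R : realType}.
Implicit Types (F G : R -> R) (a b : R^nat).

Lemma is_egfE k F a : is_egf k F a <->
  (forall n, (n < k)%N -> a n = 0) /\ has_pseries F (fun n => a n / n`!%:R).
Proof.
have E v : [series a n * (v ^+ n / n`!%:R)]_n =
    pseries (fun n => a n / n`!%:R) v.
  by apply/funext => n; apply: eq_bigr => i _ /=; rewrite mulrA mulrAC.
by split=> -[a0 Fa]; split=> //; move: Fa; apply: filterS => v; rewrite E.
Qed.

Lemma near_is_egf k F G a : (\forall v \near (0 : R)^', F v = G v) ->
  is_egf k F a -> is_egf k G a.
Proof.
move=> FG /is_egfE[a0 Fa]; apply/is_egfE; split=> //.
exact: near_has_pseries FG Fa.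
Qed.

Lemma is_egf_coef k F a : is_egf k F a -> is_egf k F (egf_coef k F).
Proof.
by move=> Fa; apply: (@getPex _ [set a | is_egf k F a]); exists a.
Qed.

Lemma egf_coefP k F b : (forall n, (n < k)%N -> b n = 0) -> has_pseries F b ->
  is_egf k F (egf_coef k F).
Proof.
move=> b0 Fb; apply: (@is_egf_coef _ _ (fun n => b n * n`!%:R)).
apply/is_egfE; split=> [n nk|].
  by rewrite b0 ?mul0r.
rewrite (_ : (fun n => _) = b)//; apply/funext => n.
by rewrite mulfK// pnatr_eq0 -lt0n fact_gt0.
Qed.

(** Uniqueness of expansions makes the choice made by [get] immaterial. *)
Lemma egf_coef_eq k F a : is_egf k F a -> egf_coef k F = a.
Proof.
move=> Fa; move: (Fa) (is_egf_coef Fa) => /is_egfE[_ {}Fa] /is_egfE[_ Fb].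
have := has_pseries_uniq Fb Fa => /funeqP E; apply/funext => n.
have n0 : (n`!%:R : R) != 0 by rewrite pnatr_eq0 -lt0n fact_gt0.
by have := E n => /(congr1 (fun y => y * n`!%:R)); rewrite !divfK.
Qed.

Lemma is_egfZ c k F a : is_egf k F a ->
  is_egf k (fun v => F v * c) (fun n => a n * c).
Proof.
move=> /is_egfE[a0 Fa]; apply/is_egfE; split=> [n nk|].
  by rewrite a0 ?mul0r.
under eq_fun do rewrite mulrC.
rewrite (_ : (fun n => _) = (fun n => c * (a n / n`!%:R))).
  exact: has_pseriesZ.
by apply/funext => n; rewrite mulrAC mulrC.
Qed.

Lemma is_egfM k F G a b : is_egf k F a -> is_egf 0 G b ->
  is_egf k (fun v => F v * G v)
    (fun n => \sum_(0 <= m < n.+1) 'C(n, m)%:R * a (n - m)%N * b m).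
Proof.
move=> /is_egfE[a0 Fa] /is_egfE[_ Gb]; apply/is_egfE; split=> [n nk|].
  rewrite big1_seq// => m _; rewrite a0 ?mulr0 ?mul0r//.
  by rewrite (leq_ltn_trans (leq_subr _ _)).
(* The factors are swapped so that the summation index of the Cauchy product falls on [b]. *)
under eq_fun do rewrite mulrC.
rewrite (_ : (fun n => _) =
  cauchy_prod (fun n => b n / n`!%:R) (fun n => a n / n`!%:R)).
  exact: has_pseriesM.
apply/funext => n; rewrite /cauchy_prod big_mkord mulr_suml.
apply: eq_bigr => i _; have iN : (i <= n)%N by rewrite -ltnS.
have fn0 m : (m`!%:R : R) != 0 by rewrite pnatr_eq0 -lt0n fact_gt0.
rewrite -(bin_fact iN) !natrM.
have bn0 : ('C(n, i)%:R : R) != 0 by rewrite pnatr_eq0 -lt0n bin_gt0.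
by field; rewrite !fn0 bn0.
Qed.

End ExponentialGeneratingFunction.

(** * Stirling and Bernoulli generating functions *)

Section ExpansionsFromMoments.
Context d (T : measurableType d) (R : realType) (P : probability T R).
Variable Y : {RV P >-> R}.
Hypothesis hY : moment_conditions Y.

Lemma prob_stirling2_is_egf r :
  is_egf r (fun v => (mgf Y v - 1) ^+ r / r`!%:R) (prob_stirling2 Y ^~ r).
Proof.
have b0 : moment Y 0 / 0`!%:R - (0 == 0)%N%:R = 0.
  by rewrite moment0 divr1 subrr.
have M := has_pseriesB (mgf_has_pseries hY) has_pseries1.
have [b Fb br] := has_pseriesX r M b0.
apply: (@egf_coefP _ _ _ (fun n => r`!%:R^-1 * b n)) => [n nr|].
  by rewrite br ?mulr0.
by under eq_fun do rewrite mulrC; exact: has_pseriesZ.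
Qed.

(** Dividing by E[Y] normalizes the constant term to 1, as [has_pseries_powR] demands. *)
Lemma mgf_shift_has_pseries : 'E_P[Y]%E <> 0%E ->
  exists2 a, has_pseries (fun v => (moment Y 1)^-1 * ((mgf Y v - 1) / v)) a &
    a 0%N = 1.
Proof.
move=> EY.
exists (fun n => (moment Y 1)^-1 * (moment Y n.+1 / n.+1`!%:R)); last first.
  rewrite divr1 mulVf//; apply/eqP => m0.
  by apply: EY; rewrite -(moment1 hY) m0.
have M := mgf_has_pseries hY.
have := has_pseriesZ (moment Y 1)^-1 (has_pseries_shift M).
by apply: near_has_pseries; apply: nearW => v; rewrite moment0 divr1.
Qed.

Lemma mgf_shift_gt0 : 'E_P[Y]%E <> 0%E ->
  \forall v \near (0 : R)^', 0 < (moment Y 1)^-1 * ((mgf Y v - 1) / v).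
Proof.
move=> /mgf_shift_has_pseries[a Ha a0].
by apply: has_pseries_gt0 Ha _; rewrite a0.
Qed.

(** With m = E[Y] and H = (M - 1) / (m v), the singular-looking factor is (v / (M - 1))^r = m^(-r)
    H^(-r), a real power of a series with constant term 1. *)
Lemma prob_bernoulli_is_egf r z : ((0 < r)%N -> 'E_P[Y]%E <> 0%E) ->
  is_egf 0 (fun v => (v / (mgf Y v - 1)) ^+ r * mgf Y v `^ z)
    (prob_bernoulli Y r z).
Proof.
move=> EY.
have M : has_pseries (fun v => mgf Y v `^ z)
    (powR_coef z (fun n => moment Y n / n`!%:R)).
  apply: has_pseries_powR _ (mgf_has_pseries hY) _.
  by rewrite moment0 divr1.
(* For [r = 0] nothing is known about E[Y], but the first factor is then 1. *)
case: r EY => [_|r /(_ isT) EY].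
  apply: (@egf_coefP _ _ _ _ _ (near_has_pseries _ M)) => //.
  by apply: nearW => v; rewrite expr0 mul1r.
have [a Ha a0] := mgf_shift_has_pseries EY.
have K := has_pseriesM (has_pseriesZ ((moment Y 1)^-1 ^+ r.+1)
  (has_pseries_powR (- r.+1%:R) Ha a0)) M.
apply: (@egf_coefP _ _ _ _ _ (near_has_pseries _ K)) => //.
near=> v; congr (_ * _).
have : 0 < (moment Y 1)^-1 * ((mgf Y v - 1) / v).
  by near: v; exact: mgf_shift_gt0.
move: (moment Y 1) (mgf Y v - 1) => m w mwv.
(* Positivity turns the real power into the inverse of an integer power. It also forces [m], [w] and
   [v] to be nonzero, since inverting 0 gives 0. *)
rewrite powR_invn ?ltW// -exprVn -exprMn; congr (_ ^+ _).
move: mwv; have [->|m0] := eqVneq m 0; first by rewrite invr0 mul0r ltxx.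
have [->|w0] := eqVneq w 0; first by rewrite mul0r mulr0 ltxx.
have [->|v0 _] := eqVneq v 0; first by rewrite invr0 !mulr0 ltxx.
by field; rewrite m0 w0 v0.
Unshelve. all: by end_near. Qed.

End ExpansionsFromMoments.

(** * The complement of a q-number and the final comparison *)

Lemma qnum_compl (R : realType) (q x : R) : 0 < q < 1 ->
  qnum q (1 - x) = 1 - qnum q^-1 x.
Proof.
move=> /andP[q0 q1]; rewrite /qnum.
have -> : q `^ (1 - x) = q / q `^ x.
  rewrite powRB; first by rewrite powRr1// ltW.
  by rewrite (gt_eqF q0) implybT.
have -> : q^-1 `^ x = (q `^ x)^-1.
  by rewrite -powR_inv1 ?ltW// -powRrM mulN1r powRN.
have qx0 : q `^ x != 0 by rewrite gt_eqF ?powR_gt0.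
by field; rewrite qx0 gt_eqF//= mulN1r !subr_eq0 (gt_eqF q1) (lt_eqF q1).
Qed.

Theorem theorem2p1 (d : measure_display) (T : measurableType d) (R : realType)
    (P : probability T R) (Y : {RV P >-> R})
    (hY : moment_conditions Y)
    (q : R) (hq : 0 < q < 1)
    (x : R) (hx : 0 <= x <= 1)
    (n r : nat) (hr : (r <= n)%N)
    (hEY : (0 < r)%N -> ('E_P[Y] <> 0)%E) :
  prob_qBernstein Y q x r n =
    \sum_(0 <= m < n.+1)
      'C(n, m)%:R * prob_stirling2 Y (n - m) r *
      prob_bernoulli Y r (1 - qnum q^-1 x) m * qnum q x ^+ r.
Proof.
rewrite /prob_qBernstein qnum_compl//.
(* By uniqueness of coefficients, it remains to compare generating functions near 0: the q-Bernstein
   one against the product of the other two, scaled by [[x]_q^r]. *)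
rewrite (egf_coef_eq (near_is_egf _ (is_egfZ (qnum q x ^+ r)
  (is_egfM (prob_stirling2_is_egf hY r)
    (prob_bernoulli_is_egf hY (1 - qnum q^-1 x) hEY))))).
  by rewrite mulr_suml.
case: r hEY {hr} => [|r] hEY.
  by apply: nearW => v; rewrite !expr0; ring.
near=> v.
(* Positivity excludes M(v) = 1 for small nonzero [v], so that (M - 1)^r cancels against the
   denominator of (v / (M - 1))^r. *)
have : 0 < (moment Y 1)^-1 * ((mgf Y v - 1) / v).
  by near: v; apply: mgf_shift_gt0 => //; exact: hEY.
have [->|w0 _] := eqVneq (mgf Y v - 1) 0; first by rewrite mul0r mulr0 ltxx.
move: w0; set w := mgf Y v - 1 => w0.
have -> : (v * qnum q x) ^+ r.+1 =
    w ^+ r.+1 * (v / w) ^+ r.+1 * qnum q x ^+ r.+1.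
  by rewrite -!exprMn [w * _]mulrC divfK.
move: (w ^+ _) ((v / w) ^+ _) => s t; ring.
Unshelve. all: by end_near. Qed.
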